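(* Let $K\hookrightarrow L$ be a simplicial pair, let $q\in\mathbb N$, and assume $n_{q+1}^{L,K}=\dim C_{q+1}^{L,K}>0$. Choose any basis of $C_{q+1}^{L,K}\subseteq C_{q+1}^L$, represented by the columns of a matrix $Z\in\mathbb{R}^{n_{q+1}^L\times n_{q+1}^{L,K}}$. Let $B_q^K$ and $B_{q+1}^{L,K}$ be the matrix representations of $\partial_q^K$ and $\partial_{q+1}^{L,K}$ (the latter with respect to the chosen basis of $C_{q+1}^{L,K}$), and let $W_q^K$ (resp. $W_q^L$) be the diagonal matrix representation of the weight function $w_q^K$ (resp. $w_q^L$). Then the matrix representation $\boldsymbol{\Delta}_q^{K,L}$ of $\Delta_q^{K,L}$ is $$\boldsymbol{\Delta}_q^{K,L}=B_{q+1}^{L,K}\left(Z^{\mathrm T}(W_{q+1}^L)^{-1}Z\right)^{-1}(B_{q+1}^{L,K})^{\mathrm T}(W_q^K)^{-1}+W_q^K(B_q^K)^{\mathrm T}(W_{q-1}^K)^{-1}B_q^K,$$ where the first summand is the matrix $\boldsymbol{\Delta}_{q,\mathrm{up}}^{K,L}$ of $\partial_{q+1}^{L,K}(\partial_{q+1}^{L,K})^*$ and the second is the matrix $\boldsymbol{\Delta}_{q,\mathrm{down}}^K$ of $(\partial_q^K)^*\partial_q^K$. Moreover, $\boldsymbol{\Delta}_q^{K,L}$ is invariant under the choice of basis for $C_{q+1}^{L,K}$.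
   Context: A simplicial complex $K$ over a finite totally ordered set $V$ is a collection of nonempty subsets of $V$ closed under taking nonempty subsets. $S_q^K$ is the set of $q$-simplices (elements of cardinality $q+1$) and $n_q^K=|S_q^K|$. Every complex $K$ carries a weight function $w^K:K\to(0,\infty)$, and $w_q^K$ is its restriction to $S_q^K$. For $\sigma\in S_q^K$, $[\sigma]$ is $\sigma$ oriented by the order of $V$. $C_q^K$ is the real vector space with basis $\{[\sigma]:\sigma\in S_q^K\}$ (and $C_{-1}^K=0$), with the inner product $\langle[\sigma],[\sigma']\rangle_{w_q^K}=\delta_{\sigma\sigma'}\,(w_q^K(\sigma))^{-1}$. The boundary operator is $\partial_q^K[v_0,\dots,v_q]=\sum_{i=0}^q(-1)^i[v_0,\dots,\hat v_i,\dots,v_q]$ for $q\geq 1$, and $\partial_0^K=0$. A simplicial pair $K\hookrightarrow L$ consists of simplicial complexes $K\subseteq L$ over the same ordered set $V$ with $w^K=w^L|_K$. Put $C_{q}^{L,K}=\{c\in C_q^L:\partial_q^L c\in C_{q-1}^K\}$, with the inner product restricted from $C_q^L$, and let $\partial_q^{L,K}:C_q^{L,K}\to C_{q-1}^K$ be the restriction of $\partial_q^L$. With $*$ denoting adjoints, $\Delta_q^{K,L}=\partial_{q+1}^{L,K}(\partial_{q+1}^{L,K})^*+(\partial_q^K)^*\partial_q^K$ on $C_q^K$. For each $q$ the $q$-simplices of $L$ are ordered as $\sigma_1,\dots,\sigma_{n_q^L}$ so that $S_q^K=\{\sigma_1,\dots,\sigma_{n_q^K}\}$; matrices of operators on $C_q^K$,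 $C_q^L$ are with respect to these ordered canonical bases, and columns of $Z$ are coordinate vectors in the canonical basis of $C_{q+1}^L$. $W_q^K$ is the diagonal matrix with $i$-th entry $w_q^K(\sigma_i)$. When $q=0$ the second summand is $0$ (since $\partial_0^K=0$). *)

(* Defs.v *)
From Stdlib Require Import ClassicalEpsilon.
From HB Require Import structures.
From mathcomp Require Import all_boot all_order all_algebra.

Set Implicit Arguments.
Unset Strict Implicit.
Unset Printing Implicit Defensive.

Import Order.TTheory GRing.Theory Num.Theory.
Local Open Scope ring_scope.

Record complex (V : finType) := Complex {
  complex_sets :> {set {set V}};
  complex_nonempty : set0 \notin complex_sets;
  complex_closed : forall s t : {set V},
    s \in complex_sets -> t \subset s -> t != set0 -> t \in complex_sets
}.

(* Only the values of [weight] on the simplices of the complex matter. *)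
Record wcomplex (V : finType) (R : realFieldType) := WComplex {
  wcomplex_complex :> complex V;
  weight : {set V} -> R;
  weight_gt0 : forall s : {set V}, s \in complex_sets wcomplex_complex ->
    0 < weight s
}.

Record simplicial_pair (V : finType) (R : realFieldType) (K L : wcomplex V R) :=
  SimplicialPair {
    pair_sub : (K : {set {set V}}) \subset (L : {set {set V}});
    pair_weight : forall s : {set V}, s \in (K : {set {set V}}) ->
      weight K s = weight L s
  }.

(* Everything graded is indexed by the number of vertices k = q + 1 instead of
   the dimension q.  Thus [simplices K q.+1] is S_q^K, and k = 0 is dimension
   -1: [simplices K 0] is empty because set0 is not in K. *)
Definition simplices (V : finType) (K : complex V) (k : nat) : {set {set V}} :=
  [set s in (K : {set {set V}}) | #|s| == k].

Notation nsimplices K k := #|simplices K k|.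

(* All chain spaces are subspaces of one ambient space, so that C_q^K is
   literally contained in C_q^L; [oriented s] is the basis element [s]. *)
Notation ambient V R := {ffun {set V} -> R^o}.

Definition oriented (V : finType) (R : realFieldType) (s : {set V}) :
    ambient V R :=
  [ffun t => (t == s)%:R].

(* C_q^K is [chains K q.+1]; [chains K 0] is the zero space C_{-1}^K. *)
Definition chains (V : finType) (R : realFieldType) (K : wcomplex V R)
    (k : nat) : {vspace ambient V R} :=
  (\sum_(s in simplices K k) <[oriented R s]>)%VS.

(* On C_q^K this is the inner product with <[s], [s']> = delta / w_q^K(s). *)
Definition inner (V : finType) (R : realFieldType) (K : wcomplex V R)
    (c c' : ambient V R) : R :=
  \sum_(s in (K : {set {set V}})) c s * c' s / weight K s.

Definition inner_on (V : finType) (R : realFieldType) (K : wcomplex V R)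
    (U : {vspace ambient V R}) (c c' : subvs_of U) : R :=
  inner K (vsval c) (vsval c').

(* If s = {v_0 < ... < v_q} then the number of vertices of s below v_i is i.
   The boundary of a single vertex is 0. *)
Definition boundary_simplex (d : Order.disp_t) (V : finOrderType d)
    (R : realFieldType) (s : {set V}) : ambient V R :=
  if (1 < #|s|)%N then
    \sum_(v in s) (-1) ^+ #|[set u in s | (u < v)%O]| *: oriented R (s :\ v)
  else 0.

Definition boundary (d : Order.disp_t) (V : finOrderType d)
    (R : realFieldType) : 'End(ambient V R) :=
  linfun (fun c : ambient V R =>
    \sum_(s : {set V}) (c s : R) *: boundary_simplex R s).

(* For f mapping U into W, the induced linear map U -> W.  The projection
   [vsproj W] is then the identity on the vectors concerned, which is the case
   for [bd] and [rel_bd] below by [bdE] and [rel_bdE]. *)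
Definition restrict (R : realFieldType) (A : vectType R) (U W : {vspace A})
    (f : 'End(A)) : 'Hom(subvs_of U, subvs_of W) :=
  linfun (fun u : subvs_of U => vsproj W (f (vsval u))).

(* The operator d_q^K is [bd K q]. *)
Definition bd (d : Order.disp_t) (V : finOrderType d) (R : realFieldType)
    (K : wcomplex V R) (q : nat) :
    'Hom(subvs_of (chains K q.+1), subvs_of (chains K q)) :=
  restrict (chains K q.+1) (chains K q) (boundary V R).

(* C_q^{L,K} is [rel_chains L K q]. *)
Definition rel_chains (d : Order.disp_t) (V : finOrderType d)
    (R : realFieldType) (L K : wcomplex V R) (q : nat) :
    {vspace ambient V R} :=
  (chains L q.+1 :&: boundary V R @^-1: chains K q)%VS.

(* The operator d_q^{L,K} is [rel_bd L K q]. *)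
Definition rel_bd (d : Order.disp_t) (V : finOrderType d) (R : realFieldType)
    (L K : wcomplex V R) (q : nat) :
    'Hom(subvs_of (rel_chains L K q), subvs_of (chains K q)) :=
  restrict (rel_chains L K q) (chains K q) (boundary V R).

Definition is_adjoint (R : realFieldType) (U W : vectType R)
    (ipU : U -> U -> R) (ipW : W -> W -> R)
    (f : 'Hom(U, W)) (g : 'Hom(W, U)) : Prop :=
  forall (u : U) (w : W), ipW (f u) w = ipU u (g w).

(* The adjoints used in the Laplacian exist and are unique: see
   [adjoint_inner_onP] and [adjoint_inner_on_unique] below. *)
Definition adjoint (R : realFieldType) (U W : vectType R)
    (ipU : U -> U -> R) (ipW : W -> W -> R) (f : 'Hom(U, W)) : 'Hom(W, U) :=
  epsilon (inhabits 0) (is_adjoint ipU ipW f).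

Definition laplacian_up (d : Order.disp_t) (V : finOrderType d)
    (R : realFieldType) (K L : wcomplex V R) (q : nat) :
    'End(subvs_of (chains K q.+1)) :=
  (rel_bd L K q.+1 \o
   adjoint (@inner_on V R L (rel_chains L K q.+1))
           (@inner_on V R K (chains K q.+1)) (rel_bd L K q.+1))%VF.

Definition laplacian_down (d : Order.disp_t) (V : finOrderType d)
    (R : realFieldType) (K : wcomplex V R) (q : nat) :
    'End(subvs_of (chains K q.+1)) :=
  (adjoint (@inner_on V R K (chains K q.+1))
           (@inner_on V R K (chains K q)) (bd K q) \o bd K q)%VF.

Definition laplacian (d : Order.disp_t) (V : finOrderType d)
    (R : realFieldType) (K L : wcomplex V R) (q : nat) :
    'End(subvs_of (chains K q.+1)) :=
  laplacian_up K L q + laplacian_down K q.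

Lemma boundaryE (d : Order.disp_t) (V : finOrderType d) (R : realFieldType)
    (c : ambient V R) :
  boundary V R c = \sum_(s : {set V}) (c s : R) *: boundary_simplex R s.
Proof.
rewrite /boundary.
have lin : linear (fun c : ambient V R =>
    \sum_(s : {set V}) (c s : R) *: boundary_simplex R s).
  move=> a u v; rewrite scaler_sumr -big_split; apply: eq_bigr => s _ /=.
  by rewrite !ffunE scalerDl scalerA.
pose h := GRing.isLinear.Build R (ambient V R) (ambient V R) *:%R _ lin.
pose F : {linear ambient V R -> ambient V R} := HB.pack (fun c : ambient V R =>
    \sum_(s : {set V}) (c s : R) *: boundary_simplex R s) h.
exact: (lfunE F c).
Qed.

Lemma mem_chains (V : finType) (R : realFieldType) (K : wcomplex V R)
    (k : nat) (c : ambient V R) :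
  reflect (forall s, s \notin simplices K k -> c s = 0) (c \in chains K k).
Proof.
apply: (iffP idP) => [/memv_sumP[f fP ->] s sK | c0].
  rewrite sum_ffunE big1 // => t tK.
  have /vlineP[a ->] := fP t tK.
  rewrite !ffunE; case: eqP => [st|_]; last by rewrite scaler0.
  by rewrite st tK in sK.
have -> : c = \sum_(s in simplices K k) (c s : R) *: oriented R s.
  apply/ffunP => t; rewrite sum_ffunE.
  have [tK|tK] := boolP (t \in simplices K k).
    rewrite (bigD1 t) //= big1 ?addr0 => [|s /andP[_ st]].
      by rewrite !ffunE eqxx; apply: esym; exact: mulr1.
    by rewrite !ffunE eq_sym (negPf st) scaler0.
  rewrite c0 // big1 // => s sK; rewrite !ffunE.
  by case: eqP => [ts|_]; [rewrite ts sK in tK | rewrite scaler0].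
apply: memv_suml => s sK; apply: memvZ.
by apply: subvP (memv_line _); apply: (sumv_sup s).
Qed.

Lemma mem_boundary (d : Order.disp_t) (V : finOrderType d)
    (R : realFieldType) (K : wcomplex V R) (q : nat) (c : ambient V R) :
  c \in chains K q.+1 -> boundary V R c \in chains K q.
Proof.
move=> /mem_chains cK; rewrite boundaryE; apply: memv_suml => s _.
have [sK|/cK->] := boolP (s \in simplices K q.+1); last first.
  by rewrite scale0r mem0v.
apply: memvZ; rewrite /boundary_simplex; case: ifP => [s1|_]; last exact: mem0v.
apply: memv_suml => v vs; apply: memvZ; apply/mem_chains => t tK.
rewrite ffunE; case: eqP => // ts; case/negP: tK.
move: sK; rewrite !inE ts => /andP[sK /eqP sq].
have sv : #|s :\ v| = q by apply: succn_inj; rewrite -sq (cardsD1 v s) vs.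
rewrite sv eqxx andbT; apply: (complex_closed sK); first exact: subD1set.
by rewrite -card_gt0 sv -ltnS -sq.
Qed.

Lemma restrictE (R : realFieldType) (A : vectType R) (U W : {vspace A})
    (f : 'End(A)) (u : subvs_of U) :
  restrict U W f u = vsproj W (f (vsval u)).
Proof.
pose F := (vsproj W \o (f \o vsval)) : subvs_of U -> subvs_of W.
exact: (lfunE (F : {linear _ -> _}) u).
Qed.

Lemma bdE (d : Order.disp_t) (V : finOrderType d) (R : realFieldType)
    (K : wcomplex V R) (q : nat) (c : subvs_of (chains K q.+1)) :
  vsval (bd K q c) = boundary V R (vsval c).
Proof. by rewrite restrictE vsprojK // mem_boundary // subvsP. Qed.

Lemma rel_bdE (d : Order.disp_t) (V : finOrderType d) (R : realFieldType)
    (L K : wcomplex V R) (q : nat) (c : subvs_of (rel_chains L K q)) :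
  vsval (rel_bd L K q c) = boundary V R (vsval c).
Proof.
rewrite restrictE vsprojK //.
by have := subvsP c; rewrite memv_cap => /andP[_]; rewrite -memv_preim.
Qed.

Definition inner_product (R : realFieldType) (U : vectType R)
    (ip : U -> U -> R) : Prop :=
  [/\ forall a u v w, ip (a *: u + v) w = a * ip u w + ip v w,
      forall u v, ip u v = ip v u
    & forall u, u != 0 -> 0 < ip u u].

Lemma inner_on_product (V : finType) (R : realFieldType) (K : wcomplex V R)
    (k : nat) (U : {vspace ambient V R}) :
  (U <= chains K k)%VS -> inner_product (@inner_on V R K U).
Proof.
move=> UK; split=> [a u v w|u v|u u0]; rewrite /inner_on /inner.
- rewrite mulr_sumr -big_split; apply: eq_bigr => s _ /=.
  by rewrite !ffunE mulrDl mulrDl !mulrA.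
- by apply: eq_bigr => s _; congr (_ / _); exact: mulrC.
have ge0 s : s \in (K : {set {set V}}) ->
    0 <= (vsval u s : R) * vsval u s / weight K s.
  move=> sK; apply: divr_ge0; last exact/ltW/weight_gt0.
  exact: (sqr_ge0 (vsval u s : R)).
rewrite lt_def sumr_ge0 // andbT; apply: contra u0 => /eqP S0.
rewrite -(inj_eq val_inj); apply/eqP/ffunP => s; rewrite [RHS]ffunE.
have [sK|sK] := boolP (s \in (K : {set {set V}})); last first.
  have /(subvP UK)/mem_chains -> := subvsP u => //.
  by rewrite inE (negPf sK).
have /eqP := psumr_eq0P ge0 S0 sK.
rewrite mulf_eq0 invr_eq0 (gt_eqF (weight_gt0 sK)) orbF.
by move=> us; apply/eqP; move: us; rewrite (mulf_eq0 (_ : R)) orbb.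
Qed.

Lemma adjoint_exists (R : realFieldType) (U W : vectType R)
    (ipU : U -> U -> R) (ipW : W -> W -> R) (f : 'Hom(U, W)) :
  inner_product ipU -> inner_product ipW -> exists g, is_adjoint ipU ipW f g.
Proof.
move=> [linU symU posU] [linW symW _].
have ip0 v : ipU 0 v = 0.
  by have := linU (-1) 0 0 v; rewrite scaler0 addr0 mulN1r addNr.
have ipS n (a : 'I_n -> R) (b : 'I_n -> U) v :
    ipU (\sum_i a i *: b i) v = \sum_i a i * ipU (b i) v.
  elim/big_rec2: _ => [|i y z _ IH]; first exact: ip0.
  by rewrite linU IH.
pose n : nat := \dim {:U}; pose b : n.-tuple U := vbasis {:U}.
have bB : basis_of {:U} b := vbasisP _.
pose G : 'M[R]_n := \matrix_(i, j) ipU b`_i b`_j.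
have uG : G \in unitmx.
  rewrite -row_free_unit; apply: inj_row_free => x xG.
  pose v := \sum_i x 0 i *: b`_i.
  have vb (j : 'I_n) : ipU v b`_j = 0.
    rewrite ipS; have := congr1 (fun M : 'rV_n => M 0 j) xG.
    rewrite !mxE; apply: etrans.
    by apply: eq_bigr => i _; rewrite [G _ _]mxE.
  have v0 : v = 0.
    apply/eqP; apply/negPn/negP => /posU; rewrite {1}/v ipS big1 ?ltxx // => i _.
    by rewrite symU vb mulr0.
  apply/rowP => i; rewrite mxE.
  by have := coord_sum_free (x 0) i (basis_free bB); rewrite -/v v0 linear0.
pose h w := (\row_j ipW (f b`_j) w) *m invmx G.
pose g w : U := \sum_i h w 0 i *: b`_i.
have linh a : {morph h : u v / a *: u + v}.
  move=> u v; rewrite /h scalemxAl -mulmxDl; congr (_ *m _).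
  by apply/rowP => j; rewrite !mxE symW linW !(symW (f _)).
have ling : linear g.
  move=> a u v; rewrite /g linh scaler_sumr -big_split; apply: eq_bigr => i _.
  by rewrite !mxE scalerDl scalerA.
pose hB := GRing.isLinear.Build R W U *:%R _ ling.
pose gl : {linear W -> U} := HB.pack g hB.
exists (linfun gl) => u w; rewrite lfunE /= /g.
have gb (j : 'I_n) : ipU (g w) b`_j = ipW (f b`_j) w.
  have <- : (h w *m G) 0 j = ipW (f b`_j) w by rewrite /h mulmxKV // mxE.
  by rewrite ipS [RHS]mxE; apply: eq_bigr => i _; rewrite [G _ _]mxE.
have ipWS m (a : 'I_m -> R) (c : 'I_m -> W) v :
    ipW (\sum_i a i *: c i) v = \sum_i a i * ipW (c i) v.
  elim/big_rec2: _ => [|i y z _ IH]; last by rewrite linW IH.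
  by have := linW (-1) 0 0 v; rewrite scaler0 addr0 mulN1r addNr.
rewrite (coord_basis bB (memvf u)) linear_sum.
under eq_bigr do rewrite linearZ.
rewrite ipWS ipS; apply: eq_bigr => i _; congr (_ * _).
by rewrite -gb symU.
Qed.

Lemma adjoint_inner_onP (V : finType) (R : realFieldType) (K L : wcomplex V R)
    (k l : nat) (U W : {vspace ambient V R})
    (f : 'Hom(subvs_of U, subvs_of W)) :
  (U <= chains L k)%VS -> (W <= chains K l)%VS ->
  is_adjoint (@inner_on V R L U) (@inner_on V R K W) f
    (adjoint (@inner_on V R L U) (@inner_on V R K W) f).
Proof.
move=> /inner_on_product ipU /inner_on_product ipW.
exact: epsilon_spec (adjoint_exists f ipU ipW).
Qed.

Lemma adjoint_inner_on_unique (V : finType) (R : realFieldType)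
    (K L : wcomplex V R) (k : nat) (U W : {vspace ambient V R})
    (f : 'Hom(subvs_of U, subvs_of W)) (g g' : 'Hom(subvs_of W, subvs_of U)) :
  (U <= chains L k)%VS ->
  is_adjoint (@inner_on V R L U) (@inner_on V R K W) f g ->
  is_adjoint (@inner_on V R L U) (@inner_on V R K W) f g' -> g = g'.
Proof.
move=> /inner_on_product[lin sym pos] gP g'P; apply/lfunP => w.
apply/eqP; rewrite -subr_eq0; apply/negPn/negP => /pos.
set x := _ - _; suff -> : inner_on L x x = 0 by rewrite ltxx.
rewrite {1}/x addrC -scaleN1r lin mulN1r !(sym _ x) -gP -g'P addNr //.
Qed.

Lemma nsimplices_le (V : finType) (R : realFieldType) (K L : wcomplex V R)
    (KL : simplicial_pair K L) (k : nat) :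
  (nsimplices K k <= nsimplices L k)%N.
Proof.
apply/subset_leq_card/subsetP => s; rewrite !inE => /andP[sK ->].
by rewrite (subsetP (pair_sub KL)).
Qed.

(* An enumeration of the simplices of L in every dimension in which the
   simplices of K come first.  Injectivity and counting make
   [simplex_at o k] a bijection onto [simplices L k]. *)
Record simplex_order (V : finType) (R : realFieldType) (K L : wcomplex V R) :=
  SimplexOrder {
    simplex_at : forall k : nat, 'I_(nsimplices L k) -> {set V};
    simplex_at_inj : forall k, injective (@simplex_at k);
    simplex_at_in : forall k i, @simplex_at k i \in simplices L k;
    simplex_at_K : forall k i,
      (@simplex_at k i \in simplices K k) = (i < nsimplices K k)%N
  }.

Definition simplexK (V : finType) (R : realFieldType) (K L : wcomplex V R)
    (KL : simplicial_pair K L) (o : simplex_order K L) (k : nat)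
    (i : 'I_(nsimplices K k)) : {set V} :=
  simplex_at o (widen_ord (nsimplices_le KL k) i).

Definition basisL (V : finType) (R : realFieldType) (K L : wcomplex V R)
    (o : simplex_order K L) (k : nat) : (nsimplices L k).-tuple (ambient V R) :=
  [tuple oriented R (simplex_at o i) | i < nsimplices L k].

Definition basisK (V : finType) (R : realFieldType) (K L : wcomplex V R)
    (KL : simplicial_pair K L) (o : simplex_order K L) (k : nat) :
    (nsimplices K k).-tuple (ambient V R) :=
  [tuple oriented R (simplexK KL o i) | i < nsimplices K k].

(* The matrix whose columns are the coordinates of the vectors of b in the
   basis e. *)
Definition coord_mx (R : realFieldType) (A : vectType R) (m n : nat)
    (e : n.-tuple A) (b : m.-tuple A) : 'M[R]_(n, m) :=
  \matrix_(i < n, j < m) coord e i (tnth b j).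

(* The matrix, acting on column vectors, of f with respect to a basis b of U
   and a basis e of W. *)
Definition repr_mx (R : realFieldType) (A : vectType R) (U W : {vspace A})
    (m n : nat) (b : m.-tuple A) (e : n.-tuple A)
    (f : 'Hom(subvs_of U, subvs_of W)) : 'M[R]_(n, m) :=
  \matrix_(i < n, j < m) coord e i (vsval (f (vsproj U (tnth b j)))).

Definition weight_mxL (V : finType) (R : realFieldType) (K L : wcomplex V R)
    (o : simplex_order K L) (k : nat) : 'M[R]_(nsimplices L k) :=
  diag_mx (\row_i weight L (simplex_at o i)).

Definition weight_mxK (V : finType) (R : realFieldType) (K L : wcomplex V R)
    (KL : simplicial_pair K L) (o : simplex_order K L) (k : nat) :
    'M[R]_(nsimplices K k) :=
  diag_mx (\row_i weight K (simplexK KL o i)).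

(* Main.v *)
Require Import Defs.
From mathcomp Require Import all_boot all_order all_algebra.

Import Order.TTheory GRing.Theory Num.Theory.
Local Open Scope ring_scope.

(** The inner products in play are restrictions of the two symmetric bilinear
    forms [inner K] and [inner L] on the ambient space, which are positive
    definite on the chains of K and of L respectively.  Given bases
    b of U and e of W with Gram matrices G_b and G_e, and a map f : U -> W with
    matrix F, the adjunction identity <f b_i, e_j> = <b_i, g e_j> reads entrywise
    F^T G_e = G_b G, where G is the matrix of g.  Positive definiteness makes G_b
    invertible, so the adjoint of f has matrix G_b^-1 F^T G_e
    ([repr_mx_adjoint]).  This single formula yields both summands:
    - a basis of simplices is orthogonal with Gram matrix W^-1
      ([gram_simplex_basis]), hence the adjoint of the boundary of K has matrix
      W_q B^T W_(q-1)^-1;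
    - a basis of relative chains with coordinate matrix Z has Gram matrix
      Z^T W^-1 Z ([gram_mxE]), hence the adjoint of the relative boundary has
      matrix (Z^T W^-1 Z)^-1 B^T W_q^-1.
    Composing with the boundaries gives the formula.  Its independence of the
    basis of relative chains is then immediate: both sides are the matrix of the
    same operator in the same basis of the chains of K. *)

Set Implicit Arguments.
Unset Strict Implicit.
Unset Printing Implicit Defensive.

(** * Gram matrices of families of chains *)

Definition gram_mx (V : finType) (R : realFieldType) (K : wcomplex V R)
    (n : nat) (b : n.-tuple (ambient V R)) : 'M[R]_n :=
  \matrix_(i, j) inner K (tnth b i) (tnth b j).

Definition simplex_basis (V : finType) (R : realFieldType) (n : nat)
    (s : 'I_n -> {set V}) : n.-tuple (ambient V R) :=
  [tuple oriented R (s i) | i < n].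

Lemma innerC (V : finType) (R : realFieldType) (K : wcomplex V R)
    (c c' : ambient V R) : inner K c c' = inner K c' c.
Proof. by apply: eq_bigr => s _; congr (_ / _); apply: mulrC. Qed.

Lemma inner_suml (V : finType) (R : realFieldType) (K : wcomplex V R)
    (n : nat) (x : 'I_n -> R) (b : 'I_n -> ambient V R) (c : ambient V R) :
  inner K (\sum_i x i *: b i) c = \sum_i x i * inner K (b i) c.
Proof.
rewrite /inner; under [RHS]eq_bigr do rewrite mulr_sumr.
rewrite exchange_big; apply: eq_bigr => s _ /=.
rewrite sum_ffunE !mulr_suml; apply: eq_bigr => i _.
by rewrite ffunE !mulrA.
Qed.

Lemma inner_sumr (V : finType) (R : realFieldType) (K : wcomplex V R)
    (n : nat) (x : 'I_n -> R) (b : 'I_n -> ambient V R) (c : ambient V R) :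
  inner K c (\sum_i x i *: b i) = \sum_i inner K c (b i) * x i.
Proof.
rewrite innerC inner_suml; apply: eq_bigr => i _.
by rewrite mulrC innerC.
Qed.

Lemma inner_eq0 (V : finType) (R : realFieldType) (K : wcomplex V R)
    (k : nat) (c : ambient V R) :
  c \in chains K k -> inner K c c = 0 -> c = 0.
Proof.
move=> cK c0; have [_ _ pos] := inner_on_product (subvv (chains K k)).
have [/(congr1 vsval)|/pos] := eqVneq (vsproj (chains K k) c) 0.
  by rewrite vsprojK // linear0.
by rewrite /inner_on vsprojK // c0 ltxx.
Qed.

Lemma coord_basis_tnth (R : realFieldType) (A : vectType R) (U : {vspace A})
    (n : nat) (b : n.-tuple A) (v : A) :
  basis_of U b -> v \in U -> v = \sum_i coord b i v *: tnth b i.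
Proof.
move=> bU vU; rewrite {1}(coord_basis bU vU).
by apply: eq_bigr => i _; rewrite (tnth_nth 0).
Qed.

(** A row vector x with x G = 0 gives a chain v = sum x_i b_i of U orthogonal to
    the basis, hence to itself; so v = 0 by definiteness and x = 0 by freeness. *)
Lemma gram_mx_unit (V : finType) (R : realFieldType) (K : wcomplex V R)
    (k n : nat) (U : {vspace ambient V R}) (b : n.-tuple (ambient V R)) :
  (U <= chains K k)%VS -> basis_of U b -> gram_mx K b \in unitmx.
Proof.
move=> /subvP UK bU; rewrite -row_free_unit; apply: inj_row_free => x xG.
pose v := \sum_i x 0 i *: tnth b i.
have vb j : inner K v (tnth b j) = 0.
  rewrite inner_suml; have := congr1 (fun M : 'rV_n => M 0 j) xG.
  rewrite !mxE; apply: etrans.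
  by apply: eq_bigr => i _; rewrite [gram_mx _ _ _ _]mxE.
have vU : v \in U.
  by apply: memv_suml => i _; apply/memvZ/(basis_mem bU)/mem_tnth.
have v0 : v = 0.
  apply: inner_eq0 (UK _ vU) _.
  by rewrite {2}/v inner_sumr big1 // => i _; rewrite vb mul0r.
apply/rowP => i; rewrite mxE.
have := coord_sum_free (x 0) i (basis_free bU).
under eq_bigr do rewrite -tnth_nth.
by rewrite -/v v0 linear0.
Qed.

(** * Bases of simplices *)

(** An injection between sets of the same cardinality is onto, so [s] enumerates
    the simplices without repetition. *)
Lemma simplex_image (V : finType) (K : complex V) (k : nat)
    (s : 'I_(nsimplices K k) -> {set V}) :
  injective s -> (forall i, s i \in simplices K k) ->
  [set s i | i : 'I_(nsimplices K k)] = simplices K k.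
Proof.
move=> sI sK; apply/eqP; rewrite eqEcard card_imset // card_ord leqnn andbT.
by apply/subsetP => _ /imsetP[i _ ->].
Qed.

Lemma sum_simplices (V : finType) (R : nmodType) (K : complex V) (k : nat)
    (s : 'I_(nsimplices K k) -> {set V}) (F : {set V} -> R) :
  injective s -> (forall i, s i \in simplices K k) ->
  \sum_(t in simplices K k) F t = \sum_i F (s i).
Proof.
move=> sI sK; have sKE := simplex_image sI sK.
rewrite (eq_bigl (mem [set s i | i : 'I_(nsimplices K k)])) => [|t].
  by rewrite big_imset // => i j _ _ /sI.
by rewrite /= sKE.
Qed.

(** Evaluating a chain at a simplex extracts its coefficient; this gives both
    the freeness of the simplices and the formula for coordinates. *)
Lemma simplex_basis_sumE (V : finType) (R : realFieldType) (n : nat)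
    (s : 'I_n -> {set V}) (x : 'I_n -> R) (i : 'I_n) :
  injective s -> (\sum_j x j *: tnth (simplex_basis R s) j) (s i) = x i.
Proof.
move=> sI; rewrite sum_ffunE (bigD1 i) //= big1 => [|j ji].
  by rewrite tnth_mktuple !ffunE eqxx addr0; apply: mulr1.
by rewrite tnth_mktuple !ffunE (inj_eq sI) eq_sym (negPf ji) scaler0.
Qed.

Lemma simplex_basisP (V : finType) (R : realFieldType) (K : wcomplex V R)
    (k : nat) (s : 'I_(nsimplices K k) -> {set V}) :
  injective s -> (forall i, s i \in simplices K k) ->
  basis_of (chains K k) (simplex_basis R s).
Proof.
move=> sI sK; apply/andP; split; last first.
  apply/freeP => x x0 i; rewrite -(simplex_basis_sumE x i sI).
  by under eq_bigr do rewrite (tnth_nth 0); rewrite x0 ffunE.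
rewrite eqEsubv; apply/andP; split.
  apply/span_subvP => _ /tnthP[i ->]; rewrite tnth_mktuple.
  apply/mem_chains => t tK; rewrite ffunE.
  by case: eqP => // ts; rewrite ts sK in tK.
apply/subv_sumP => t tK.
have /imsetP[i _ ->] : t \in [set s i | i : 'I_(nsimplices K k)].
  by rewrite simplex_image.
rewrite -memvE; apply: memv_span; apply/tnthP.
by exists i; rewrite tnth_mktuple.
Qed.

Lemma coord_simplex_basis (V : finType) (R : realFieldType) (K : wcomplex V R)
    (k : nat) (s : 'I_(nsimplices K k) -> {set V}) (i : 'I_(nsimplices K k))
    (c : ambient V R) :
  injective s -> (forall i, s i \in simplices K k) -> c \in chains K k ->
  coord (simplex_basis R s) i c = c (s i).
Proof.
move=> sI sK cK.
rewrite {2}(coord_basis_tnth (simplex_basisP sI sK) cK).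
by rewrite simplex_basis_sumE.
Qed.

Lemma invmx_weight (V : finType) (R : realFieldType) (K : wcomplex V R)
    (k n : nat) (s : 'I_n -> {set V}) :
  (forall i, s i \in simplices K k) ->
  invmx (diag_mx (\row_i weight K (s i))) =
    diag_mx (\row_i (weight K (s i))^-1).
Proof.
move=> sK; set D := diag_mx _; set D' := diag_mx _.
have D'D : D' *m D = 1%:M.
  rewrite mulmx_diag -diag_const_mx; congr diag_mx; apply/rowP => i.
  rewrite !mxE mulVf // gt_eqF // weight_gt0 //.
  by have := sK i; rewrite inE => /andP[].
have [_ uD] := mulmx1_unit D'D.
by rewrite -[LHS]mul1mx -D'D mulmxK.
Qed.

(** In the coordinates of the simplices [inner] is the diagonal form with entries
    1 / w, so passing to the family b conjugates that form by the coordinate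
    matrix of b. *)
Lemma gram_mxE (V : finType) (R : realFieldType) (K : wcomplex V R)
    (k n : nat) (s : 'I_(nsimplices K k) -> {set V})
    (b : n.-tuple (ambient V R)) :
  injective s -> (forall i, s i \in simplices K k) ->
  (forall j, tnth b j \in chains K k) ->
  gram_mx K b = (coord_mx (simplex_basis R s) b)^T
    *m invmx (diag_mx (\row_i weight K (s i)))
    *m coord_mx (simplex_basis R s) b.
Proof.
move=> sI sK bK; rewrite (invmx_weight sK); apply/matrixP => i j.
rewrite mul_mx_diag !mxE /inner (big_setID (simplices K k)) /= addrC.
(* The chains vanish at the simplices of other dimensions. *)
rewrite big1.
  have /setIidPr-> : simplices K k \subset (K : {set {set V}}).
    by apply/subsetP => t; rewrite inE => /andP[].
  rewrite add0r (sum_simplices _ sI sK).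
  apply: eq_bigr => l _; rewrite !mxE !(coord_simplex_basis _ sI sK (bK _)).
  by rewrite mulrAC.
move=> t; rewrite inE => /andP[tK _].
by move/mem_chains: (bK i) => -> //; rewrite !mul0r.
Qed.

Lemma gram_simplex_basis (V : finType) (R : realFieldType) (K : wcomplex V R)
    (k : nat) (s : 'I_(nsimplices K k) -> {set V}) :
  injective s -> (forall i, s i \in simplices K k) ->
  gram_mx K (simplex_basis R s) = invmx (diag_mx (\row_i weight K (s i))).
Proof.
move=> sI sK; have sB := simplex_basisP (R := R) sI sK.
rewrite (gram_mxE sI sK) => [|j]; last exact/(basis_mem sB)/mem_tnth.
suff -> : coord_mx (simplex_basis R s) (simplex_basis R s) = 1%:M.
  by rewrite trmx1 mul1mx mulmx1.
apply/matrixP => i j.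
by rewrite !mxE (tnth_nth 0) coord_free ?(basis_free sB) // eq_sym.
Qed.

(** * Matrices of linear maps and of their adjoints *)

Lemma repr_mx_sum (R : realFieldType) (A : vectType R) (U W : {vspace A})
    (m n : nat) (b : m.-tuple A) (e : n.-tuple A)
    (f : 'Hom(subvs_of U, subvs_of W)) (j : 'I_m) :
  basis_of W e ->
  vsval (f (vsproj U (tnth b j))) = \sum_i repr_mx b e f i j *: tnth e i.
Proof.
move=> eW; rewrite {1}(coord_basis_tnth eW (subvsP _)).
by apply: eq_bigr => i _; rewrite mxE.
Qed.

Lemma repr_mx_comp (R : realFieldType) (A : vectType R) (U W X : {vspace A})
    (m n p : nat) (b : m.-tuple A) (e : n.-tuple A) (h : p.-tuple A)
    (f : 'Hom(subvs_of U, subvs_of W)) (g : 'Hom(subvs_of W, subvs_of X)) :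
  basis_of W e ->
  repr_mx b h (g \o f)%VF = repr_mx e h g *m repr_mx b e f.
Proof.
move=> eW; apply/matrixP => i j; rewrite !mxE comp_lfunE.
rewrite -[f _]vsvalK (repr_mx_sum _ _ _ eW) !linear_sum.
by apply: eq_bigr => l _; rewrite !linearZ /= !mxE mulrC.
Qed.

Lemma repr_mxD (R : realFieldType) (A : vectType R) (U W : {vspace A})
    (m n : nat) (b : m.-tuple A) (e : n.-tuple A)
    (f g : 'Hom(subvs_of U, subvs_of W)) :
  repr_mx b e (f + g) = repr_mx b e f + repr_mx b e g.
Proof. by apply/matrixP => i j; rewrite !mxE add_lfunE !linearD. Qed.

(** Testing <f u, w> = <u, g w> on basis vectors gives F^T G_e = G_b G, which
    is solved for G since G_b is invertible. *)
Lemma repr_mx_adjoint (V : finType) (R : realFieldType) (K L : wcomplex V R)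
    (k l m n : nat) (U W : {vspace ambient V R}) (b : m.-tuple (ambient V R))
    (e : n.-tuple (ambient V R)) (f : 'Hom(subvs_of U, subvs_of W)) :
  (U <= chains L k)%VS -> (W <= chains K l)%VS ->
  basis_of U b -> basis_of W e ->
  repr_mx e b (adjoint (@inner_on V R L U) (@inner_on V R K W) f) =
    invmx (gram_mx L b) *m (repr_mx b e f)^T *m gram_mx K e.
Proof.
move=> UL WK bU eW; have := adjoint_inner_onP f UL WK.
set g := adjoint _ _ _ => gP.
rewrite -mulmxA; apply: (canRL (mulKmx (gram_mx_unit UL bU))).
apply/matrixP => i j; rewrite !mxE.
have := gP (vsproj U (tnth b i)) (vsproj W (tnth e j)).
rewrite /inner_on !(repr_mx_sum _ _ _ eW, repr_mx_sum _ _ _ bU).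
rewrite !vsprojK ?(basis_mem bU, basis_mem eW, mem_tnth) //.
rewrite inner_suml inner_sumr => fg; symmetry; apply: etrans (etrans fg _).
  by apply: eq_bigr => l' _; rewrite !mxE.
by apply: eq_bigr => l' _; rewrite !mxE.
Qed.

Theorem theorem3p1 (d : Order.disp_t) (V : finOrderType d) (R : realFieldType)
    (K L : wcomplex V R) (KL : simplicial_pair K L) (o : simplex_order K L)
    (q : nat) (hdim : (0 < \dim (rel_chains L K q.+1))%N) :
  let m := \dim (rel_chains L K q.+1) in
  let Z (b : m.-tuple (ambient V R)) := coord_mx (basisL o q.+2) b in
  let Brel (b : m.-tuple (ambient V R)) :=
    repr_mx b (basisK KL o q.+1) (rel_bd L K q.+1) in
  let B := repr_mx (basisK KL o q.+1) (basisK KL o q) (bd K q) in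
  let WL_up := weight_mxL o q.+2 in
  let WK := weight_mxK KL o q.+1 in
  let WK_down := weight_mxK KL o q in
  let mx (f : 'End(subvs_of (chains K q.+1))) :=
    repr_mx (basisK KL o q.+1) (basisK KL o q.+1) f in
  let gram (b : m.-tuple (ambient V R)) := (Z b)^T *m invmx WL_up *m Z b in
  let up (b : m.-tuple (ambient V R)) :=
    Brel b *m invmx (gram b) *m (Brel b)^T *m invmx WK in
  let down := WK *m B^T *m invmx WK_down *m B in
  (forall b : m.-tuple (ambient V R), basis_of (rel_chains L K q.+1) b ->
     [/\ gram b \in unitmx,
         mx (laplacian_up K L q) = up b,
         mx (laplacian_down K q) = down
       & mx (laplacian K L q) = up b + down]) /\
  (forall b b' : m.-tuple (ambient V R),
     basis_of (rel_chains L K q.+1) b -> basis_of (rel_chains L K q.+1) b' ->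
     up b + down = up b' + down).
Proof.
move=> m Z Brel B WL_up WK WK_down mx gram up down.
have LI k := @simplex_at_inj _ _ _ _ o k.
have LP k := @simplex_at_in _ _ _ _ o k.
have KI k : injective (@simplexK _ _ _ _ KL o k).
  by move=> i j /LI/(congr1 val) ij; apply: val_inj.
have KP k i : @simplexK _ _ _ _ KL o k i \in simplices K k.
  by rewrite /simplexK simplex_at_K /= ltn_ord.
have KB k : basis_of (chains K k) (basisK KL o k) := simplex_basisP (KI k) (KP k).
have gramK k : gram_mx K (basisK KL o k) = invmx (weight_mxK KL o k).
  exact: gram_simplex_basis (KI k) (KP k).
have relL : (rel_chains L K q.+1 <= chains L q.+2)%VS by apply: capvSl.
have gramE (b : m.-tuple (ambient V R)) :
    basis_of (rel_chains L K q.+1) b -> gram b = gram_mx L b.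
  move=> bB; symmetry; apply: gram_mxE (LI _) (LP _) _ => j.
  by apply/(subvP relL)/(basis_mem bB)/mem_tnth.
have upE (b : m.-tuple (ambient V R)) :
    basis_of (rel_chains L K q.+1) b -> mx (laplacian_up K L q) = up b.
  move=> bB; rewrite /mx /laplacian_up (repr_mx_comp _ _ _ _ bB).
  rewrite (repr_mx_adjoint _ relL (subvv _) bB (KB _)) gramK -gramE //.
  by rewrite /up !mulmxA.
have downE : mx (laplacian_down K q) = down.
  rewrite /mx /laplacian_down (repr_mx_comp _ _ _ _ (KB q)).
  rewrite (repr_mx_adjoint _ (subvv _) (subvv _) (KB _) (KB _)) !gramK.
  (* The Gram matrix of the domain is W^-1, and the adjoint formula inverts it. *)
  by rewrite invmxK.
have lapE (b : m.-tuple (ambient V R)) :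
    basis_of (rel_chains L K q.+1) b ->
    mx (laplacian K L q) = up b + down.
  by move=> bB; rewrite -(upE b bB) -downE; apply: repr_mxD.
split=> [b bB|b b' bB b'B]; last by rewrite -!lapE.
split; [|exact: upE|exact: downE|exact: lapE].
by rewrite gramE //; apply: gram_mx_unit relL bB.
Qed.
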